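(* Let $V$ be a finite-dimensional Euclidean vector space, let $\mathcal{U}\subseteq V$ be a convex and compact set that is not a singleton, let $\mathcal{X}$ be a subset of a finite-dimensional Euclidean vector space, and let $f\colon \mathcal{X}\times\mathcal{U}\to\mathbb{R}$ be such that $f(x,\cdot)\colon\mathcal{U}\to\mathbb{R}$ is affine for every $x\in\mathcal{X}$. Consider the robust optimization problem $$(\mathrm{P})\qquad \sup_{x\in\mathcal{X}}\min_{p\in\mathcal{U}} f(x,p).$$ Let $x^*\in\mathcal{X}^{\mathrm{RO}}$ be a robustly optimal solution of $(\mathrm{P})$, let $\hat p\in\mathrm{relint}(\mathcal{U})$ be arbitrary, and consider the optimization problem $$(\mathrm{Q})\qquad \sup_{y}\ f(y,\hat p)\quad\text{s.t.}\quad \min_{p\in\mathcal{U}}\bigl(f(y,p)-f(x^*,p)\bigr)\ge 0,\quad y\in\mathcal{X}.$$ Then: (i) $x^*$ is a Pareto robustly optimal (PRO) solution of $(\mathrm{P})$ if and only if $x^*$ is an optimal solution of $(\mathrm{Q})$. (ii) Every feasible solution $y$ of $(\mathrm{Q})$ with objective value $f(y,\hat p)>f(x^*,\hat p)$ Pareto dominates $x^*$. (iii) If $(\mathrm{Q})$ has an optimal solution, then this optimal solution is a PRO solution of $(\mathrm{P})$.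
   Context: $\mathrm{relint}(\mathcal{U})$ denotes the relative interior of $\mathcal{U}$. $\mathcal{X}^{\mathrm{RO}}$ denotes the set of robustly optimal solutions, i.e. the set of optimal solutions of $(\mathrm{P})$: those $x\in\mathcal{X}$ for which $\min_{p\in\mathcal{U}}f(x,p)$ attains the supremum in $(\mathrm{P})$. A robustly optimal solution $x\in\mathcal{X}^{\mathrm{RO}}$ is called Pareto robustly optimal (PRO), written $x\in\mathcal{X}^{\mathrm{PRO}}$, if there is no $\bar x\in\mathcal{X}$ such that $f(\bar x,p)\ge f(x,p)$ for all $p\in\mathcal{U}$ and $f(\bar x,\bar p)>f(x,\bar p)$ for at least one $\bar p\in\mathcal{U}$. An $\bar x\in\mathcal{X}$ satisfying these two conditions is said to Pareto dominate $x$. An optimal solution of a supremum problem is a feasible point attaining the supremum. *)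

(* Defs.v *)
From HB Require Import structures.
From mathcomp Require Import all_boot all_order all_algebra sesquilinear.
From mathcomp Require Import all_classical all_reals all_analysis.

Set Implicit Arguments.
Unset Strict Implicit.
Unset Printing Implicit Defensive.

Import Order.TTheory GRing.Theory Num.Theory.
Import numFieldNormedType.Exports.

Local Open Scope classical_set_scope.
Local Open Scope ring_scope.

Definition finite_dimensional (R : realType) (V : lmodType R) : Prop :=
  exists (n : nat) (b : 'I_n -> V),
    forall v : V, exists c : 'I_n -> R, v = \sum_(i < n) c i *: b i.

(* The norm, hence the topology, of V comes from an inner product
   ([{dot V for idfun}] is a symmetric positive definite bilinear form). *)
Definition euclidean (R : realType) (V : normedModType R) : Prop :=
  finite_dimensional V /\
  exists dot : {dot V for idfun}, forall v : V, `|v| ^+ 2 = dot v v.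

Definition affine_set (R : realType) (V : lmodType R) (A : set V) : Prop :=
  forall (p q : V) (t : R), A p -> A q -> A (t *: p + (1 - t) *: q).

Definition affine_hull (R : realType) (V : lmodType R) (A : set V) : set V :=
  smallest (@affine_set R V) A.

Definition relint (R : realType) (V : normedModType R) (A : set V) : set V :=
  [set p | A p /\ \forall q \near p, affine_hull A q -> A q].

(* Affinity of g as a function on the convex set A; the values of g outside A
   are irrelevant. *)
Definition affine_on (R : realType) (V : lmodType R) (A : set V) (g : V -> R)
    : Prop :=
  forall (p q : V) (t : R), A p -> A q -> 0 <= t <= 1 ->
    g (t *: p + (1 - t) *: q) = t * g p + (1 - t) * g q.

(* The least element of A; the default value 0 is returned when there is
   none. *)
Definition minimum (R : realType) (A : set R) : R := xget 0 (A `&` lbound A).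

(* The supremum is taken in the extended reals, so that it always exists. *)
Definition optimal_solution (R : realType) (T : Type) (F : set T) (g : T -> R)
    : set T :=
  [set x | F x /\ (g x)%:E = ereal_sup [set (g y)%:E | y in F]].

Section robust_optimization.
Context (R : realType) (W V : Type) (X : set W) (U : set V) (f : W -> V -> R).

Definition robustly_optimal : set W :=
  optimal_solution X (fun x => minimum [set f x p | p in U]).

Definition pareto_dominates (xbar x : W) : Prop :=
  [/\ X xbar, forall p, U p -> f x p <= f xbar p
    & exists2 pbar, U pbar & f x pbar < f xbar pbar].

Definition pareto_robustly_optimal : set W :=
  [set x | robustly_optimal x /\ ~ exists xbar, pareto_dominates xbar x].

(* Problem Q maximises the value at the single scenario phat among the points
   that are at least as good as xstar in every scenario of U. *)
Definition Q_feasible (xstar : W) : set W :=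
  [set y | 0 <= minimum [set f y p - f xstar p | p in U] /\ X y].

Definition Q_optimal (xstar : W) (phat : V) : set W :=
  optimal_solution (Q_feasible xstar) (fun y => f y phat).

End robust_optimization.

(* Main.v *)
Require Import Defs.
From HB Require Import structures.
From mathcomp Require Import all_boot all_order all_algebra sesquilinear.
From mathcomp Require Import all_classical all_reals all_analysis.
From mathcomp Require Import ring.

Set Implicit Arguments.
Unset Strict Implicit.
Unset Printing Implicit Defensive.

Import Order.TTheory GRing.Theory Num.Theory.
Import numFieldNormedType.Exports.

Local Open Scope classical_set_scope.
Local Open Scope ring_scope.

(** Two facts about a function h that is affine on U carry the theorem.

    The first is about relative interior points.  If h is nonnegative on U and
    positive at some q in U, then h is positive at every p in relint U: the
    segment from q to p can be prolonged inside U to a point s beyond p, so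
    h p is a weighted mean of h s >= 0 and h q > 0, the latter with a positive
    weight ([affine_relint_gt0]).  Applied to h = f z - f y, it says that a
    point z dominating y is strictly better than y already in the scenario
    phat.  Hence domination of y implies a strict improvement at phat, and
    conversely a point as good as y everywhere and better at phat dominates y.

    The second is that the minimum of h over the compact set U exists, so that
    the objective of (P) and the constraint of (Q) mean what they should:
    c <= min h iff c <= h on U ([le_minimum_affine]).  Affinity is only
    known on U, so continuity of h has to be proved.  The increments of h
    define a linear functional on the span of the differences of points of U
    ([secant]); that span has a finite orthonormal basis
    ([orthonormal_basis]), and in its coordinates the functional is visibly
    bounded by a multiple of the norm.  Thus h is Lipschitz on U
    ([affine_on_lipschitz]), and a continuous function attains its minimum on
    a compact set.

    Now (Q) maximises the value at phat over the points that are at least as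
    good as xstar in every scenario.  An improvement of xstar at phat by such
    a point is a domination of xstar, and a domination of an optimal point y
    of (Q) would be a feasible improvement of y at phat.  A feasible point of
    (Q) is robustly optimal because its worst case is no worse than that of
    xstar. *)

(** * The linear functional induced by an affine function on a convex set *)

Section secant.
Context (R : realType) (V : lmodType R) (U : set V) (convexU : convex_set U).
Context (g : V -> R) (g_affine : affine_on U g).

(** Affinity and convexity with weights that need not sum to 1, so that
    callers never have to normalise. *)
Lemma affine_on_weighted_mean (a b : R) (p q : V) :
    0 <= a -> 0 <= b -> 0 < a + b -> U p -> U q ->
  exists r, [/\ U r, (a + b) *: r = a *: p + b *: q
    & (a + b) * g r = a * g p + b * g q].
Proof.
move=> a0 b0 ab0 Up Uq; have abN0 : a + b != 0 by rewrite gt_eqF.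
have ab1 : b / (a + b) = 1 - a / (a + b) by field.
have t01 : 0 <= a / (a + b) <= 1.
  by rewrite divr_ge0 ?(ltW ab0)//= ler_pdivrMr// mul1r lerDl.
exists ((a / (a + b)) *: p + (b / (a + b)) *: q); split.
- rewrite ab1; case/andP: (t01) => t0 t1.
  have := convexU (Itv01 t0 t1) (mem_set Up) (mem_set Uq).
  by move/set_mem.
- by rewrite scalerDr !scalerA !(mulrC (a + b)) !divfK.
- by rewrite ab1 g_affine// -ab1; field.
Qed.

(** The graph of the linear functional that sends p - q to g p - g q, extended
    to the span of the differences of points of U.  It is a relation because
    the value at v must be shown not to depend on p and q; a single difference
    is enough because convexity lets sums of differences be merged. *)
Definition secant (v : V) (y : R) :=
  exists a p q, [/\ 0 <= a, U p, U q, v = a *: (p - q) & y = a * (g p - g q)].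

Lemma secant0 p : U p -> secant 0 0.
Proof. by move=> Up; exists 0, p, p; rewrite scale0r mul0r. Qed.

(** A negative scalar is absorbed by exchanging the two endpoints. *)
Lemma secantZ c v y : secant v y -> secant (c *: v) (c * y).
Proof.
move=> [a [p [q [a0 Up Uq -> ->]]]]; have [c0|c0] := leP 0 c.
  by exists (c * a), p, q; split; rewrite ?mulr_ge0// ?scalerA ?mulrA.
exists (- c * a), q, p; split=> //; first by rewrite mulr_ge0// oppr_ge0 ltW.
  by rewrite scalerA -opprB scalerN mulNr scaleNr.
by ring.
Qed.

(** Averaging the two heads and the two tails with weights a and b gives points
    of U whose difference, scaled by a + b, is the sum. *)
Lemma secantD v v' y y' : secant v y -> secant v' y' -> secant (v + v') (y + y').
Proof.
move=> [a [p [q [a0 Up Uq -> ->]]]] [b [p' [q' [b0 Up' Uq' -> ->]]]].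
have [ab|] := leP (a + b) 0.
  have a_0 : a = 0 by apply/le_anti; rewrite a0 (le_trans _ ab)// lerDl.
  have b_0 : b = 0 by apply/le_anti; rewrite b0 (le_trans _ ab)// lerDr.
  by exists 0, p, q; rewrite a_0 b_0 !scale0r !mul0r !addr0.
move=> ab.
have [r [Ur rE gr]] := affine_on_weighted_mean a0 b0 ab Up Up'.
have [s [Us sE gs]] := affine_on_weighted_mean a0 b0 ab Uq Uq'.
exists (a + b), r, s; split=> //; first exact: ltW.
  by rewrite [RHS]scalerBr rE sE !scalerBr opprD addrACA.
by rewrite [RHS]mulrBr gr gs; ring.
Qed.

(** Together with [secantZ] and [secantD], this makes the graph
    single-valued. *)
Lemma secant_fun0 y : secant 0 y -> y = 0.
Proof.
move=> [a [p [q [a0 _ _ /esym/eqP]]]].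
rewrite scaler_eq0 subr_eq0 => /orP[/eqP->|/eqP->] ->; first by rewrite mul0r.
by rewrite subrr mulr0.
Qed.

Lemma secant_sum k (c y : nat -> R) (e : nat -> V) p : U p ->
  (forall i, (i < k)%N -> secant (e i) (y i)) ->
  secant (\sum_(i < k) c i *: e i) (\sum_(i < k) c i * y i).
Proof.
move=> Up; elim: k => [|k IHk] ey; first by rewrite !big_ord0; exact: secant0 Up.
rewrite !big_ord_recr/=; apply: secantD; last exact/secantZ/ey.
by apply: IHk => i ik; apply: ey; rewrite ltnS ltnW.
Qed.

End secant.

(** * Orthonormal bases of subspaces *)

Section dot.
Context (R : realType) (V : lmodType R) (dot : {dot V for idfun}).

(** Families are indexed by nat with only the first k terms relevant, so that
    extending a family by one vector needs no change of index type. *)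
Definition orthonormal_upto (k : nat) (e : nat -> V) :=
  forall i j, (i < k)%N -> (j < k)%N -> dot (e i) (e j) = (i == j)%:R.

Lemma dotC u v : dot u v = dot v u.
Proof. by rewrite hermC expr0 mul1r. Qed.

Lemma dotZr a u v : dot u (a *: v) = a * dot u v.
Proof. by rewrite linearZr_LR. Qed.

Lemma dotZl a u v : dot (a *: u) v = a * dot u v.
Proof. by rewrite linearZl_LR. Qed.

Lemma dot_ge0 v : 0 <= dot v v.
Proof.
have [->|v0] := eqVneq v 0; first by rewrite linear0r.
by rewrite ltW// neq0_dnorm_gt0.
Qed.

Lemma orthonormal_coord k e (c : 'I_k -> R) (j : 'I_k) : orthonormal_upto k e ->
  dot (\sum_(i < k) c i *: e i) (e j) = c j.
Proof.
move=> oe; rewrite linear_sumlz (bigD1 j)//= big1 => [|i /negPf ij].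
  by rewrite dotZl oe// eqxx mulr1 addr0.
by rewrite dotZl oe// -[(i : nat) == j]/(i == j) ij mulr0.
Qed.

(** If k > n, the k x n matrix of coordinates has a nonzero left kernel, which
    is a nontrivial linear relation between the orthonormal vectors. *)
Lemma orthonormal_size n (b : 'I_n -> V) k e :
  (forall v, exists c : 'I_n -> R, v = \sum_(i < n) c i *: b i) ->
  orthonormal_upto k e -> (k <= n)%N.
Proof.
move=> b_span oe; rewrite leqNgt; apply/negP => nk.
have [A eA] := choice (fun i : 'I_k => b_span (e i)).
pose M : 'M[R]_(k, n) := \matrix_(i, j) A i j.
have : kermx M != 0.
  by rewrite kermx_eq0 /row_free neq_ltn (leq_ltn_trans (rank_leq_col M))//.
case/rowV0Pn => u /sub_kermxP uM0 /eqP[].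
have e0 : \sum_(i < k) u 0 i *: e i = 0.
  under eq_bigr do rewrite eA scaler_sumr.
  rewrite exchange_big big1//= => j _.
  under eq_bigr do rewrite scalerA.
  rewrite -scaler_suml; have /matrixP/(_ 0 j) := uM0; rewrite !mxE => uM0j.
  rewrite -[X in X *: _](_ : 0 = _) ?scale0r// -[LHS]uM0j.
  by apply: eq_bigr => i _; rewrite mxE.
apply/rowP => j.
by rewrite mxE -(@orthonormal_coord _ _ (fun i => u 0 i) j oe) e0 linear0l.
Qed.

(** As long as an orthonormal family in L fails to expand some v in L, the
    normalised residual of v extends it; by [orthonormal_size] this must stop.
    Building a basis of L itself, not of V, makes its vectors available
    to whatever is defined only on L. *)
Lemma orthonormal_basis (L : set V) : finite_dimensional V ->
  L 0 -> (forall u v, L u -> L v -> L (u + v)) ->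
  (forall (a : R) v, L v -> L (a *: v)) ->
  exists k e, [/\ orthonormal_upto k e, forall i, (i < k)%N -> L (e i)
    & forall v, L v -> v = \sum_(i < k) dot v (e i) *: e i].
Proof.
move=> [n [b b_span]] L0 LD LZ; apply: contrapT => noB.
suff [e [/(orthonormal_size b_span)]] : exists e, orthonormal_upto n.+1 e /\
    forall i, (i < n.+1)%N -> L (e i) by rewrite ltnn.
elim: n.+1 => [|k [e [oe Le]]]; first by exists (fun=> 0).
have [v Lv] : exists2 v, L v & v != \sum_(i < k) dot v (e i) *: e i.
  apply: contrapT => noV; apply: noB; exists k, e; split=> // v Lv.
  by apply/eqP; apply: contrapT => /negP vN; apply: noV; exists v.
set w := \sum_(i < k) _ => vw.
have Lw : L (v - w).
  apply: (LD _ _ Lv); rewrite -scaleN1r; apply: (LZ).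
  rewrite /w; elim/big_ind: _ => // i _; exact/LZ/Le.
have d0 : 0 < dot (v - w) (v - w) by rewrite neq0_dnorm_gt0// subr_eq0.
pose c := (Num.sqrt (dot (v - w) (v - w)))^-1.
have vw_e i : (i < k)%N -> dot (v - w) (e i) = 0.
  move=> ik; rewrite linearBl/= /w.
  by rewrite (@orthonormal_coord k e (fun i => dot v (e i)) (Ordinal ik))// subrr.
exists (fun i => if (i < k)%N then e i else c *: (v - w)); split; last first.
  by move=> i _; case: ifP => [/Le//|_]; exact: LZ.
move=> i j; rewrite !ltnS => ik jk.
case: ltnP => ki; case: ltnP => kj; first exact: oe.
- by rewrite dotZr dotC vw_e// mulr0 (ltn_eqF (leq_trans ki kj)).
- by rewrite dotZl vw_e// mulr0 (gtn_eqF (leq_trans kj ki)).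
- have -> : i = j by apply/eqP; rewrite eqn_leq (leq_trans ik)// (leq_trans jk).
  rewrite eqxx dotZl dotZr mulrA -expr2 exprVn sqr_sqrtr ?ltW//.
  by rewrite mulVf// gt_eqF.
Qed.

End dot.

(** * Affine functions attain their minimum on compact convex sets *)

Section lipschitz.
Context (R : realType) (V : normedModType R).

(** Bessel's inequality for one vector: the squared norm of
    v - (dot v e) *: e is `|v| ^+ 2 - dot v e ^+ 2, hence this difference is
    nonnegative. *)
Lemma dot_unit_le (dot : {dot V for idfun}) (v e : V) :
  (forall v : V, `|v| ^+ 2 = dot v v) -> dot e e = 1 -> `|dot v e| <= `|v|.
Proof.
move=> normE e1; rewrite -(ler_pXn2r (ltn0Sn 1)) ?nnegrE// real_normK ?num_real//.
rewrite normE -subr_ge0.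
have := dot_ge0 dot (v - dot v e *: e).
rewrite linearBl/= !linearBr/= !dotZl !dotZr e1 (dotC _ e v).
by congr (0 <= _); ring.
Qed.

(** In an orthonormal basis e of the span of differences, g p - g q is the sum
    of the coordinates of p - q, each at most `|p - q|, times the values y of
    the induced functional at the basis vectors. *)
Lemma affine_on_lipschitz (U : set V) (g : V -> R) :
  euclidean V -> convex_set U -> affine_on U g ->
  exists K : R, forall p q, U p -> U q -> `|g p - g q| <= K * `|p - q|.
Proof.
move=> [Vfin [dot normE]] convexU g_affine.
have [[p0 Up0]|U0] := pselect (exists p, U p); last first.
  by exists 0 => p q Up; case: U0; exists p.
pose L : set V := [set v | exists y, secant U g v y].
have [|||k [e [oe Le e_span]]] := @orthonormal_basis _ _ dot L Vfin.
- by exists 0; exact: secant0 Up0.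
- by move=> u v [y uy] [z vz]; exists (y + z); exact: secantD.
- by move=> a v [y vy]; exists (a * y); exact: secantZ.
have /choice[y ey] : forall i, exists y, (i < k)%N -> secant U g (e i) y.
  move=> i; have [/Le[y iy]|_] := ltnP i k; last by exists 0.
  by exists y.
exists (\sum_(i < k) `|y i|) => p q Up Uq.
have pq : secant U g (p - q) (g p - g q).
  by exists 1, p, q; rewrite scale1r mul1r.
have -> : g p - g q = \sum_(i < k) dot (p - q) (e i) * y i.
  have : secant U g (p - q) (\sum_(i < k) dot (p - q) (e i) * y i).
    (* only the vector argument is expanded, not the coordinates in the sum *)
    rewrite {1}[p - q]e_span; last by exists (g p - g q).
    exact: (secant_sum convexU g_affine (fun i => dot (p - q) (e i)) Up0 ey).
  move=> /(secantZ (-1))/(secantD convexU g_affine pq).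
  by rewrite scaleN1r subrr mulN1r => /secant_fun0/subr0_eq.
rewrite (le_trans (ler_norm_sum _ _ _))// mulr_suml ler_sum// => i _.
rewrite normrM mulrC ler_wpM2l//; apply: dot_unit_le => //.
by rewrite oe// eqxx.
Qed.

(** [minimum] has a default value when no least element exists, so this
    equivalence relies on the minimum being attained. *)
Lemma le_minimum_affine (U : set V) (g : V -> R) (c : R) :
  euclidean V -> convex_set U -> compact U -> U !=set0 -> affine_on U g ->
  c <= minimum [set g p | p in U] <-> forall p, U p -> c <= g p.
Proof.
move=> euclidV convexU compactU U0 g_affine.
have [K gK] := affine_on_lipschitz euclidV convexU g_affine.
have [p /set_mem Up p_min] : exists2 p, p \in U & forall q, q \in U -> g p <= g q.
  apply: compact_EVT_min => //; apply/subspace_continuousP => p Up.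
  apply/cvgrPdist_lt => eps eps0.
  have K1 : 0 < `|K| + 1 by rewrite ltr_wpDl.
  near=> q.
  have Uq : U q by near: q; exact: withinT.
  rewrite (le_lt_trans (gK _ _ Up Uq))//.
  have pq : `|p - q| < eps / (`|K| + 1).
    near: q; apply: cvg_within.
    by apply/nbhs_normP; exists (eps / (`|K| + 1)) => //=; rewrite divr_gt0.
  rewrite (@le_lt_trans _ _ ((`|K| + 1) * `|p - q|))//.
    by rewrite ler_wpM2r// (le_trans (ler_norm K))// lerDl.
  by rewrite mulrC -ltr_pdivlMr.
rewrite /minimum; case: xgetP => [m _ [[q Uq <-] q_min]|].
  split=> [cq r Ur|]; last exact.
  by rewrite (le_trans cq)// q_min//; exists r.
move=> /(_ (g p)) []; split; first by exists p.
by move=> _ [q Uq <-]; apply: p_min; rewrite inE.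
Unshelve. all: by end_near. Qed.

(** * Affine functions at relative interior points *)

(** The prolonged point lies on the line through p and q, hence in the affine
    hull, and near p; so it is in U. *)
Lemma relint_prolong (U : set V) (p q : V) : relint U p -> U q ->
  exists2 eps : R, 0 < eps & U (p + eps *: (p - q)).
Proof.
move=> [Up /nbhs_normP[r /= r0 rU]] Uq.
have d0 : 0 < `|p - q| + 1 by rewrite ltr_wpDl.
exists (r / (`|p - q| + 1)); first by rewrite divr_gt0.
set eps := r / _; have eps0 : 0 < eps by rewrite divr_gt0.
apply: rU => /=.
  rewrite opprD addrA subrr sub0r normrN normrZ gtr0_norm//.
  by rewrite /eps mulrAC ltr_pdivrMr// ltr_pM2l// ltrDl.
have -> : p + eps *: (p - q) = (1 + eps) *: p + (1 - (1 + eps)) *: q.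
  by rewrite scalerDl scale1r opprD addrA subrr sub0r scaleNr scalerBr addrA.
by move=> A [affA UA]; apply: affA; exact: UA.
Qed.

(** With s the prolonged point, (1 + eps) p = s + eps q, and h q > 0 enters the
    mean with the positive weight eps. *)
Lemma affine_relint_gt0 (U : set V) (h : V -> R) (p q : V) :
  convex_set U -> affine_on U h -> relint U p ->
  (forall r, U r -> 0 <= h r) -> U q -> 0 < h q -> 0 < h p.
Proof.
move=> convexU h_affine rp h0 Uq hq.
have [eps eps0 Us] := relint_prolong rp Uq.
have eps1 : 0 < 1 + eps by rewrite ltr_wpDl.
have [r [_ rE hr]] :=
  affine_on_weighted_mean convexU h_affine ler01 (ltW eps0) eps1 Us Uq.
have rp_eq : r = p.
  apply: (@scalerI _ _ (1 + eps)); first by rewrite gt_eqF.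
  by rewrite rE scale1r scalerBr -addrA subrK scalerDl scale1r.
have : 0 < (1 + eps) * h r.
  by rewrite hr mul1r ltr_wpDl ?h0// mulr_gt0.
by rewrite rp_eq pmulr_rgt0.
Qed.

End lipschitz.

(** * The robust problem and its Pareto refinement *)

Lemma affine_onB (R : realType) (V : lmodType R) (U : set V) (g h : V -> R) :
  affine_on U g -> affine_on U h -> affine_on U (fun p => g p - h p).
Proof. by move=> ga ha p q t Up Uq t01; rewrite ga// ha//; ring. Qed.

Lemma optimal_solutionP (R : realType) (T : Type) (F : set T) (g : T -> R) x :
  optimal_solution F g x <-> F x /\ forall y, F y -> g y <= g x.
Proof.
split=> [[Fx gx]|[Fx gx]]; split=> //.
  by move=> y Fy; rewrite -lee_fin gx; apply: ereal_sup_ubound; exists y.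
apply/le_anti/andP; split; first by apply: ereal_sup_ubound; exists x.
by apply: ge_ereal_sup => _ [y Fy <-]; rewrite lee_fin gx.
Qed.

Theorem theorem1 (R : realType) (V W : normedModType R)
    (euclidV : euclidean V) (euclidW : euclidean W)
    (U : set V) (convexU : convex_set U) (compactU : compact U)
    (U_not_singleton : ~ exists p : V, U = [set p])
    (X : set W) (f : W -> V -> R)
    (f_affine : forall x : W, X x -> affine_on U (f x))
    (xstar : W) (xstar_RO : robustly_optimal X U f xstar)
    (phat : V) (phat_relint : relint U phat) :
  [/\ pareto_robustly_optimal X U f xstar <-> Q_optimal X U f xstar phat xstar,
      forall y : W, Q_feasible X U f xstar y -> f xstar phat < f y phat ->
        pareto_dominates X U f y xstar
    & forall y : W, Q_optimal X U f xstar phat y ->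
        pareto_robustly_optimal X U f y].
Proof.
have U0 : U !=set0 by exists phat; case: phat_relint.
have Up : U phat by case: phat_relint.
have [Xs sRO] := (optimal_solutionP _ _ _).1 xstar_RO.
have le_min y c : X y ->
    c <= minimum [set f y p | p in U] <-> forall p, U p -> c <= f y p.
  by move=> Xy; apply: le_minimum_affine => //; exact: f_affine.
have feasP y : Q_feasible X U f xstar y <->
    X y /\ forall p, U p -> f xstar p <= f y p.
  have le_minB : X y -> 0 <= minimum [set f y p - f xstar p | p in U] <->
      forall p, U p -> 0 <= f y p - f xstar p.
    move=> Xy; apply: (@le_minimum_affine _ _ U (fun p => f y p - f xstar p)) => //.
    exact: affine_onB (f_affine _ Xy) (f_affine _ Xs).
  split=> [[+ Xy]|[Xy ys]]; rewrite /Q_feasible/=.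
    by move=> /(le_minB Xy) ys; split=> // p /ys; rewrite subr_ge0.
  by split=> //; apply/(le_minB Xy) => p /ys; rewrite subr_ge0.
have dom_lt y z : X y -> pareto_dominates X U f z y -> f y phat < f z phat.
  move=> Xy [Xz yz [q Uq yzq]]; rewrite -subr_gt0.
  apply: (affine_relint_gt0 convexU (affine_onB (f_affine _ Xz) (f_affine _ Xy))
    phat_relint _ Uq); last by rewrite subr_gt0.
  by move=> p /yz; rewrite subr_ge0.
have lt_dom y : Q_feasible X U f xstar y -> f xstar phat < f y phat ->
    pareto_dominates X U f y xstar.
  by move=> /feasP[Xy ys] lty; split=> //; exists phat.
have opt_PRO y : Q_optimal X U f xstar phat y -> pareto_robustly_optimal X U f y.
  move=> /optimal_solutionP[/feasP[Xy ys] y_opt]; split.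
    apply/optimal_solutionP; split=> // z Xz; rewrite (le_trans (sRO z Xz))//.
    apply/le_min => // p Up'; rewrite (le_trans _ (ys p Up'))//.
    by move: p Up'; exact/le_min.
  case=> z zy; have := dom_lt _ _ Xy zy; rewrite ltNge => /negP; apply.
  case: zy => Xz yz _; apply/y_opt/feasP; split=> // p Up'.
  exact: le_trans (ys p Up') (yz p Up').
split=> //; split=> [[_ nodom]|/opt_PRO//].
apply/optimal_solutionP; split; first exact/feasP.
move=> y Fy; rewrite leNgt; apply/negP => lty.
by apply: nodom; exists y; exact: lt_dom.
Qed.
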